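(* Let $(A,\phi)$ be a noncommutative probability space over $\mathbb K$, $I$ an index set, $\epsilon_{ij}=\epsilon_{ji}\in\{0,1\}$ for $i,j\in I$, and $(A_i)_{i\in I}$ unital subalgebras of $A$ with the same unit as $A$, such that the algebras $A_i$ and $A_j$, for $i\neq j$, commute whenever $\epsilon_{ij}=1$. Then the following statements are equivalent: (i) The subalgebras $A_i$, $i\in I$, are $\epsilon$-independent. (ii) For all $n\geq 2$, all $(i_1,\dots,i_n)\in I^n$ and all $a_j\in A_{i_j}$ ($1\le j\le n$), we have $k_\epsilon(a_1,\dots,a_n)=0$ whenever there exist $1\leq l<k\leq n$ with $i_l\neq i_k$.
   Context: $\mathbb K$ is a field of characteristic zero. A noncommutative probability space $(A,\phi)$ is an associative unital $\mathbb K$-algebra $A$ with a linear functional $\phi:A\to\mathbb K$, $\phi(1_A)=1$. $I$ is a (finite or infinite) index set, $\epsilon_{ij}=\epsilon_{ji}\in\{0,1\}$ for $i,j\in I$; the diagonal values $\epsilon_{ii}$ are arbitrary in $\{0,1\}$. $[n]=\{1,\dots,n\}$. $\epsilon$-independence. $I_n^\epsilon$ is the set of $n$-tuples $(i(1),\dots,i(n))\in I^n$ such that whenever $i(k)=i(l)$ with $1\le k<l\le n$, there exists $k<p<l$ with $i(p)\neq i(k)$ and $\epsilon_{i(p)i(k)}=0$. Unital subalgebras $A_i\subset A$ (sharing the unit $1_A$), $i\in I$, are $\epsilon$-independent iff (1) $A_i$ and $A_j$ commute for all $i\ne j$ with $\epsilon_{ij}=1$, and (2) for all $n\ge 1$,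 $(i(1),\dots,i(n))\in I_n^\epsilon$ and $(a_1,\dots,a_n)\in A_{i(1)}\times\cdots\times A_{i(n)}$ with $\phi(a_k)=0$ for all $k$, one has $\phi(a_1\cdots a_n)=0$. (The diagonal values $\epsilon_{ii}$ play no role here.) Decorated partitions. A decoration is a map $d:[n]\to I$. A $d$-decorated partition of $[n]$ is a set partition $\Gamma=\Gamma_1\coprod\cdots\coprod\Gamma_k$ of $[n]$ (blocks non-empty), each $j\in[n]$ carrying the decoration $d(j)$; $\mathcal P_n^d$ is the set of these. For $\sigma\in S_n$, $\sigma(\Gamma)$ is the partition with blocks $\sigma(\Gamma_i)$, decorated by $\sigma(d):=d\circ\sigma^{-1}$. For a decorated partition of a finite set $X=\{x_1<\dots<x_n\}$ of integers with decoration $d:X\to I$, its standardization $st$ is the decorated partition of $[n]$ obtained by relabelling $x_j\mapsto j$, with decoration $st(d)(j)=d(x_j)$. Allowed moves. For $\Gamma\in\mathcal P_n^d$, the transposition $\tau_i=(i,i+1)$ is an allowed move, from $\Gamma$ to the $\tau_i(d)$-decorated partition $\tau_i(\Gamma)$, if $\epsilon_{d(i)d(i+1)}=1$ and either $d(i)\ne d(i+1)$, or $d(i)=d(i+1)$ and $i,i+1$ belong to different blocks of $\Gamma$. A permutation $\sigma=\tau_{i_k}\cdots\tau_{i_1}$ (possibly the empty product) is an allowed permutation of $\Gamma$ if each $\tau_{i_j}$ is an allowed move from $\tau_{i_{j-1}}\cdots\tau_{i_1}(\Gamma)$ to $\tau_{i_j}\cdots\tau_{i_1}(\Gamma)$.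 $\epsilon$-noncrossing partitions. A reduction of $\Gamma$ is a pair $(\sigma,i)$ with $\sigma$ an allowed permutation of $\Gamma$ and $i$ such that $\sigma(\Gamma_i)$ is an interval (set of consecutive integers) in $[n]$; it reduces $\Gamma$ to the standardization of the decorated partition obtained from $\sigma(\Gamma)$ by deleting the block $\sigma(\Gamma_i)$. $\Gamma$ is $\epsilon$-noncrossing if it can be reduced to the empty partition by a sequence of reductions. $\mathcal P_n^{d,\epsilon}\subset\mathcal P_n^d$ is the subset of $\epsilon$-noncrossing partitions. $\epsilon$-cumulants. For every $n\ge1$ and $d\in I^{[n]}$, $k_\epsilon$ is the linear map $A_{d(1)}\otimes\cdots\otimes A_{d(n)}\to\mathbb K$ (written $k_\epsilon(a_1,\dots,a_n)$; it depends on the decoration $d$ recording the subalgebra to which each argument is regarded as belonging) defined inductively by $$\phi(a_1\cdots a_n)=\sum_{\Gamma\in\mathcal P_n^{d,\epsilon}}k_\epsilon^\Gamma(a_1,\dots,a_n),$$ where $k_\epsilon^\Gamma(a_1,\dots,a_n)=\prod_{V\text{ block of }\Gamma}k_\epsilon(a_V)$ and, for $V=\{v_1<\dots<v_p\}$, $k_\epsilon(a_V)=k_\epsilon(a_{v_1},\dots,a_{v_p})$ with the decoration restricted from $d$. In (ii), $k_\epsilon(a_1,\dots,a_n)$ is taken with decoration $d(j)=i_j$. *)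

(* Defs.v *)
From HB Require Import structures.
From mathcomp Require Import all_boot all_order all_algebra all_fingroup.
From mathcomp Require Import boolp.

Set Implicit Arguments.
Unset Strict Implicit.
Unset Printing Implicit Defensive.

Import GRing.Theory.
Local Open Scope ring_scope.

(* [n] is rendered as 'I_n, and a family indexed by [n] (a decoration, a tuple
   of elements) as a function on 'I_n. A decorated partition of [n] is a pair
   (d, G) with d : 'I_n -> I and G : {set {set 'I_n}} such that
   partition G [set: 'I_n]. *)

Section Standardization.
Variable n : nat.

(* For X = {x_1 < ... < x_m}, the increasing map j |-> x_j (see incl_lt), i.e.
   the inverse of the relabelling x_j |-> j. *)
Definition incl (X : {set 'I_n}) (j : 'I_#|X|) : 'I_n := enum_val j.

Definition st (X : {set 'I_n}) (G : {set {set 'I_n}}) : {set {set 'I_#|X|}} :=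
  [set @incl X @^-1: B | B : {set 'I_n} in G].

Definition act (s : 'S_n) (G : {set {set 'I_n}}) : {set {set 'I_n}} :=
  [set s @: B | B : {set 'I_n} in G].

Definition is_interval (X : {set 'I_n}) : Prop :=
  exists a b : nat, forall x : 'I_n, (x \in X) = (a <= x <= b)%N.

End Standardization.

Section Noncrossing.
Variables (I : Type) (eps : I -> I -> bool).

Definition act_deco n (s : 'S_n) (d : 'I_n -> I) : 'I_n -> I := d \o s^-1%g.

Definition allowed_move n (d : 'I_n -> I) (G : {set {set 'I_n}})
    (i j : 'I_n) : Prop :=
  [/\ j = i.+1 :> nat, eps (d i) (d j) = true &
      d i <> d j \/ (d i = d j /\ pblock G i <> pblock G j)].

(* The product of permutations in MathComp applies its left factor first. *)
Inductive allowed_perm n (d : 'I_n -> I) (G : {set {set 'I_n}}) :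
    'S_n -> Prop :=
| allowed_perm1 : allowed_perm d G 1%g
| allowed_permM (s : 'S_n) (i j : 'I_n) :
    allowed_perm d G s -> allowed_move (act_deco s d) (act s G) i j ->
    allowed_perm d G (s * tperm i j)%g.

Inductive eps_noncrossing :
    forall n, ('I_n -> I) -> {set {set 'I_n}} -> Prop :=
| eps_noncrossing_empty (d : 'I_0 -> I) : eps_noncrossing d set0
| eps_noncrossing_reduce n (d : 'I_n -> I) (G : {set {set 'I_n}})
    (s : 'S_n) (B : {set 'I_n}) :
    allowed_perm d G s -> B \in G -> is_interval (s @: B) ->
    eps_noncrossing (act_deco s d \o @incl n (~: (s @: B)))
                    (st (~: (s @: B)) (act s G :\ s @: B)) ->
    eps_noncrossing d G.

Definition eps_nc_partitions n (d : 'I_n -> I) : {set {set {set 'I_n}}} :=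
  [set G | partition G [set: 'I_n] & `[< eps_noncrossing d G >]].

Definition reduced_word n (i : 'I_n -> I) : Prop :=
  forall k l : 'I_n, (k < l)%N -> i k = i l ->
    exists p : 'I_n, [/\ (k < p < l)%N, i p <> i k & eps (i p) (i k) = false].

End Noncrossing.

Section Cumulants.
Variables (K : fieldType) (A : algType K) (phi : {scalar A}).
Variables (I : Type) (eps : I -> I -> bool).

(* The defining relation of the cumulants, solved for the term of the one-block
   partition. The first argument bounds the recursion depth; any bound >= n
   gives the same value. The functional k_eps on A_{d(1)} (x) ... (x) A_{d(n)}
   is the restriction of cumulant _ _ d, which makes sense on all of A^n; the
   moment-cumulant formula is moment_cumulant below. *)
Fixpoint cumulant_rec (m n : nat) (d : 'I_n -> I) (a : 'I_n -> A) : K :=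
  if m is m'.+1 then
    phi (\prod_(j < n) a j) -
    \sum_(G in eps_nc_partitions eps d | G != [set [set: 'I_n]])
      \prod_(V in G) cumulant_rec m' (d \o @incl n V) (a \o @incl n V)
  else 0.

Definition cumulant n (d : 'I_n -> I) (a : 'I_n -> A) : K :=
  cumulant_rec n d a.

Definition commuting_family (S : I -> {pred A}) : Prop :=
  forall i j, i <> j -> eps i j = true ->
    forall a b, a \in S i -> b \in S j -> a * b = b * a.

Definition eps_independent (S : I -> {pred A}) : Prop :=
  commuting_family S /\
  forall n (i : 'I_n -> I) (a : 'I_n -> A), (0 < n)%N -> reduced_word eps i ->
    (forall k, a k \in S (i k)) -> (forall k, phi (a k) = 0) ->
    phi (\prod_(k < n) a k) = 0.

End Cumulants.

Lemma incl_lt n (X : {set 'I_n}) (j k : 'I_#|X|) :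
  (j < k)%N -> (incl j < incl k)%N.
Proof.
move=> ltjk; pose x0 := incl j.
have srt : sorted ltn (map val (enum X)).
  rewrite -[enum X]/(filter (mem X) (Finite.enum 'I_n)).
  apply: (subseq_sorted ltn_trans (map_subseq _ (filter_subseq _ _))).
  by rewrite -enumT val_enum_ord iota_ltn_sorted.
rewrite /incl !(enum_val_nth x0) -!(nth_map x0 0%N val) -?cardE //.
by apply: (sorted_ltn_nth ltn_trans _ srt); rewrite // inE size_map -cardE.
Qed.

Lemma card_block n (G : {set {set 'I_n}}) (V : {set 'I_n}) :
  partition G [set: 'I_n] -> V \in G -> G != [set [set: 'I_n]] ->
  (0 < #|V| < n)%N.
Proof.
move=> pG VG GT; have /and3P[_ trG n0G] := pG; apply/andP; split.
  by rewrite card_gt0; apply: contraNneq n0G => <-.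
rewrite -[X in (_ < X)%N]card_ord -cardsT proper_card // properT.
apply: contra GT => /eqP VT; rewrite eqEsubset sub1set -VT VG andbT.
apply/subsetP => W WG; rewrite inE; apply/negPn/negP => WV.
move/trivIsetP: trG => /(_ W V WG VG WV) dWV; move: n0G dWV.
by rewrite VT -setI_eq0 setIT => /negP n0 /eqP W0; case: n0; rewrite -W0.
Qed.

Section MomentCumulant.
Variables (K : fieldType) (A : algType K) (phi : {scalar A}).
Variables (I : Type) (eps : I -> I -> bool).

Lemma cumulant_rec_eq m m' n (d : 'I_n -> I) (a : 'I_n -> A) :
  (n <= m)%N -> (n <= m')%N -> (0 < n)%N ->
  cumulant_rec phi eps m d a = cumulant_rec phi eps m' d a.
Proof.
elim: m m' n d a => [|m IH] [|m'] [|n] d a // nm nm' _ /=.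
congr (_ - _); apply: eq_bigr => G /andP[].
rewrite inE => /andP[pG _] GT; apply: eq_bigr => V VG.
have /andP[V0 Vn] := card_block pG VG GT.
by apply: IH => //; rewrite -ltnS (leq_trans Vn).
Qed.

Lemma eps_noncrossing1 n (d : 'I_n -> I) :
  (0 < n)%N -> eps_noncrossing eps d [set [set: 'I_n]].
Proof.
move=> n0.
have e1 : (1%g : 'S_n) @: [set: 'I_n] = setT.
  by apply/setP => x; rewrite !inE; apply/imsetP; exists x; rewrite ?perm1.
apply: (@eps_noncrossing_reduce _ _ _ _ _ 1%g setT);
  [exact: allowed_perm1 | exact: set11 | | ].
  exists 0%N, n => x; rewrite e1 inE leq0n /=; apply/esym/ltnW/ltn_ord.
have -> : act (1%g : 'S_n) [set setT] :\ (1%g : 'S_n) @: setT = set0.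
  by rewrite /act imset_set1 setDv.
rewrite /st imset0; set d' := (X in eps_noncrossing _ X _); move: d'.
have -> : #|~: ((1%g : 'S_n) @: [set: 'I_n])| = 0%N by rewrite e1 setCT cards0.
exact: eps_noncrossing_empty.
Qed.

Lemma cumulant_setT n (d : 'I_n -> I) (a : 'I_n -> A) :
  cumulant phi eps (d \o @incl n setT) (a \o @incl n setT) =
  cumulant phi eps d a.
Proof.
have e : n = #|[set: 'I_n]| by rewrite cardsT card_ord.
have inclE (j : 'I_#|[set: 'I_n]|) : incl j = cast_ord (esym e) j.
  apply: val_inj => /=; have x0 : 'I_n := incl j.
  rewrite /incl (enum_val_nth x0) enum_setT -enumT nth_enum_ord //.
  by rewrite -[X in (_ < X)%N](etrans (cardsT 'I_n) (card_ord n)) ltn_ord.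
suff H m (f : 'I_m -> 'I_n) (e' : m = n) : (forall j, f j = cast_ord e' j) ->
  cumulant phi eps (d \o f) (a \o f) = cumulant phi eps d a by exact: H inclE.
case: n / e' d a f {e inclE} => d a f Hf.
suff -> : f = id by [].
by apply/funext => j; rewrite Hf; apply: val_inj.
Qed.

Lemma moment_cumulant n (d : 'I_n -> I) (a : 'I_n -> A) : (0 < n)%N ->
  phi (\prod_(j < n) a j) =
  \sum_(G in eps_nc_partitions eps d)
    \prod_(V in G) cumulant phi eps (d \o @incl n V) (a \o @incl n V).
Proof.
move=> n0; have T0 : [set: 'I_n] != set0 by rewrite -card_gt0 cardsT card_ord.
have inT : [set [set: 'I_n]] \in eps_nc_partitions eps d.
  rewrite inE; apply/andP; split; last by apply/asboolP/eps_noncrossing1.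
  rewrite /partition cover1 eqxx trivIset1 inE eq_sym T0 //.
rewrite (bigD1 _ inT) /= big_set1 cumulant_setT.
have -> : cumulant phi eps d a = phi (\prod_(j < n) a j) -
    \sum_(G in eps_nc_partitions eps d | G != [set [set: 'I_n]])
      \prod_(V in G) cumulant phi eps (d \o @incl n V) (a \o @incl n V).
  rewrite {1}/cumulant; case: n n0 d a T0 inT => // n _ d a T0 inT /=.
  congr (_ - _); apply: eq_bigr => G /andP[].
  rewrite inE => /andP[pG _] GT; apply: eq_bigr => V VG.
  by have /andP[V0 Vn] := card_block pG VG GT; apply: cumulant_rec_eq.
by rewrite subrK.
Qed.

End MomentCumulant.

(* Main.v *)
Require Import Defs.
From HB Require Import structures.
From mathcomp Require Import all_boot all_order all_algebra all_fingroup.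
From mathcomp Require Import boolp.
From mathcomp Require Import zify.
Import GRing.Theory.
Local Open Scope ring_scope.
Set Implicit Arguments.
Unset Strict Implicit.
Unset Printing Implicit Defensive.

(** The key observation is that for a partition whose blocks are monochrome
    (the decoration is constant on each block) being epsilon-noncrossing just
    means that no two blocks with non-commuting decorations cross
    ([admissibleP]). Indeed moves preserve the relative order of non-commuting
    elements, so such a crossing can never be undone, and neither of its two
    blocks can be made an interval; conversely, in the absence of such
    crossings, the block whose least element is largest commutes with all the
    foreign elements in its hull and can be gathered into an interval.

    Write M(X) for the moment of the arguments at the positions in X, and Psi(X)
    for the sum, over the admissible (monochrome and uncrossed) partitions of X,
    of the products of cumulants. The moment-cumulant formula on [n] reads
    M = Psi + (terms with a mixed block), and on a set of positions with a
    single decoration it reads M = Psi.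

    If mixed cumulants vanish, then M = Psi on [n]. When the decoration is a
    reduced word, every admissible partition has a singleton block
    ([reduced_singleton]), so that Psi, hence the moment, is 0 for centered
    arguments.

    Conversely, assume independence. It suffices to show M = Psi on all sets of
    positions, since the cumulant of a mixed family is then the only term left
    in the difference M - Psi, by induction on the number of arguments.
    Independence computes M recursively by three rules: merge two arguments from
    the same algebra that commutations bring together, split off the mean of an
    argument and drop the resulting unit, and discard centered reduced words. So
    it is enough that Psi obeys the same rules, which is plain for the last one.
    For the others, fix a colour c and the blocks of the other colours. The
    blocks of colour c must not cross those with which they do not commute: this
    says that they refine the partition of the positions of colour c into
    classes of [linked] positions, and positions of different classes do not
    constrain each other. Summing over the blocks of colour c therefore gives
    the product of the moments of these classes ([cumulant_sum_class],
    [cumulant_sum_at]). Hence Psi depends on the arguments of colour c through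
    ordinary moments only, for which merging, linearity and dropping units are
    obvious; no formula for cumulants with products as arguments is needed. *)

(** * Ordered products *)

(** The family [a] with its value at [x] replaced by [b]. *)
Definition upd (T : eqType) (R : Type) (a : T -> R) (x : T) (b : R) : T -> R :=
  fun y => if y == x then b else a y.

Lemma upd_at (T : eqType) (R : Type) (a : T -> R) x b : upd a x b x = b.
Proof. by rewrite /upd eqxx. Qed.

Lemma upd_out (T : eqType) (R : Type) (a : T -> R) x b y :
  y != x -> upd a x b y = a y.
Proof. by rewrite /upd => /negbTE ->. Qed.

Lemma upd_id (T : eqType) (R : Type) (a : T -> R) x : upd a x (a x) = a.
Proof. by apply/funext => y; rewrite /upd; case: eqP => // ->. Qed.

Section OrderedProducts.
Variables (R : pzSemiRingType) (n : nat).
Implicit Types (a f : 'I_n -> R) (X : {set 'I_n}).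

Lemma prod_cut (k : nat) (P : pred 'I_n) f :
  \prod_(y | P y) f y =
  (\prod_(y | P y && (y < k)%N) f y) * \prod_(y | P y && (k <= y)%N) f y.
Proof.
rewrite big_mkcond (big_mkcond (fun y => P y && (y < k)%N)).
rewrite (big_mkcond (fun y => P y && (k <= y)%N)) /=.
elim: n P f => [|m IHm] P f; first by rewrite !big_ord0 mul1r.
rewrite !big_ord_recr /= (IHm (P \o _) (f \o _)) /=.
case: ltnP => [le_mk|le_km]; rewrite ?andbT ?andbF ?mulr1 ?mulrA //.
rewrite -!mulrA; congr (_ * _); rewrite big1 ?mul1r ?mulr1 // => i _.
by rewrite leqNgt (ltn_trans _ le_mk) ?andbF.
Qed.

Lemma prod_at (x : 'I_n) (P : pred 'I_n) f : P x ->
  \prod_(y | P y) f y =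
  (\prod_(y | P y && (y < x)%N) f y) * f x *
  \prod_(y | P y && (x < y)%N) f y.
Proof.
move=> Px; rewrite (prod_cut x) (prod_cut x.+1 (fun y => P y && (x <= y)%N)).
rewrite (@big_pred1 _ _ _ _ x
          (fun y => (P y && (x <= y)%N) && (y < x.+1)%N)) => [|y]; last first.
  rewrite /= -andbA ltnS; case: (eqVneq y x) => [->|/eqP yx];
    first by rewrite Px; lia.
  have {}yx : y <> x :> nat by move=> e; apply: yx; apply: val_inj.
  by apply/negbTE/negP => /andP[_]; lia.
rewrite mulrA; congr (_ * _); apply: eq_bigl => y.
by rewrite -andbA; congr (_ && _); lia.
Qed.

(** The remaining factors [L] and [M] do not depend on the one at [x], so that
    the product is linear in the latter. *)
Lemma prod_upd a X x : x \in X ->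
  exists L M : R, forall b, \prod_(y in X) upd a x b y = L * b * M.
Proof.
move=> Xx; exists (\prod_(y | (y \in X) && (y < x)%N) a y).
exists (\prod_(y | (y \in X) && (x < y)%N) a y) => b.
rewrite (@prod_at x (fun y => y \in X)) // upd_at; congr (_ * _ * _).
  by apply: eq_bigr => y /andP[_ yx]; rewrite upd_out //;
    apply: contraTneq yx => ->; rewrite ltnn.
by apply: eq_bigr => y /andP[_ yx]; rewrite upd_out //;
  apply: contraTneq yx => ->; rewrite ltnn.
Qed.

Lemma prod_upd1 a X x :
  \prod_(y in X) upd a x 1 y = \prod_(y in X :\ x) a y.
Proof.
rewrite big_mkcond [RHS]big_mkcond; apply: eq_bigr => y _.
by rewrite !inE /upd; case: eqP => //= _; rewrite if_same.
Qed.

(** A factor that commutes with everything between it and an earlier factor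
    can be merged into the latter. *)
Lemma prod_merge a X p q : p \in X -> q \in X -> (p < q)%N ->
  (forall y, y \in X -> (p < y < q)%N -> a y * a q = a q * a y) ->
  \prod_(y in X) a y = \prod_(y in X :\ q) upd a p (a p * a q) y.
Proof.
move=> Xp Xq pq comm.
have Xqp : p \in X :\ q.
  by rewrite !inE Xp andbT; apply: contraTneq pq => ->; rewrite ltnn.
rewrite (@prod_at p (fun y => y \in X)) ?Xp //.
rewrite (@prod_at p (fun y => y \in X :\ q)) ?Xqp // upd_at.
rewrite (@prod_at q (fun y => (y \in X) && (p < y)%N)) ?Xq //.
rewrite (prod_cut q (fun y => (y \in X :\ q) && (p < y)%N)) !mulrA.
set L := \prod_(y | _) _; set C := \prod_(y | _) _; set D := \prod_(y | _) _.
set L' := \prod_(y | _) _; set C' := \prod_(y | _) _; set D' := \prod_(y | _) _.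
have -> : L' = L.
  apply: eq_big => [y|y /andP[_ yp]].
    by rewrite /= !inE; case: eqP => // ->; rewrite Xq /=; lia.
  by rewrite upd_out //; apply: contraTneq yp => ->; rewrite ltnn.
have -> : C' = C.
  apply: eq_big => [y|y /andP[/andP[_ yp] _]].
    by rewrite /= !inE; case: eqP => // ->; rewrite ltnn !andbF.
  by rewrite upd_out //; apply: contraTneq yp => ->; rewrite ltnn.
have -> : D' = D.
  apply: eq_big => [y|y /andP[/andP[_ yp] _]].
    rewrite /= !inE; case: eqP => [->|yq]; rewrite ?ltnn ?andbF //=.
    have yq' : y <> q :> nat by move=> /val_inj/yq.
    by lia.
  by rewrite upd_out //; apply: contraTneq yp => ->; rewrite ltnn.
congr (_ * _); rewrite -!mulrA; congr (_ * (_ * _)).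
apply/esym/commr_prod => y /andP[/andP[Xy py] yq].
by apply/esym/comm; rewrite ?py.
Qed.

Lemma prod_incl a X :
  \prod_(x in X) a x = \prod_(j < #|X|) a (incl j).
Proof.
rewrite -big_filter -[filter _ _]/(enum X).
case: (pickP (mem X)) => [x0 _|X0]; last first.
  have X00 : X = set0 by apply/setP => x; rewrite inE; apply: X0.
  rewrite X00 enum_set0 big_nil big1 // => -[m ltm]; exfalso.
  by move: ltm; rewrite cards0.
rewrite (big_nth x0) -cardE big_mkord; apply: eq_bigr => j _.
by rewrite /incl (enum_val_nth x0).
Qed.

End OrderedProducts.

(** * Partitions of a disjoint union *)

Section PartitionElements.
Variable T : finType.
Implicit Types (G : {set {set T}}) (V X Y Z : {set T}).

Lemma partition_sub G X V : partition G X -> V \in G -> V \subset X.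
Proof. by move=> /and3P[/eqP <- _ _] GV; apply: bigcup_sup GV. Qed.

Lemma partition_exists G X x :
  partition G X -> x \in X -> exists2 V, V \in G & x \in V.
Proof. by move=> /and3P[/eqP <- _ _] /bigcupP[V GV Vx]; exists V. Qed.

Lemma partition_inj G X U V x : partition G X -> U \in G -> V \in G ->
  x \in U -> x \in V -> U = V.
Proof.
move=> /and3P[_ triv _] GU GV Ux Vx.
by rewrite -(def_pblock triv GU Ux) (def_pblock triv GV Vx).
Qed.

Lemma partition_inhab G X V : partition G X -> V \in G -> exists x, x \in V.
Proof.
move=> /and3P[_ _ nG0] GV; apply/set0Pn.
by apply: contraNneq nG0 => <-.
Qed.

Lemma partitionI G X :
  (forall V, V \in G -> V \subset X) ->
  (forall V, V \in G -> exists x, x \in V) ->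
  (forall x, x \in X -> exists2 V, V \in G & x \in V) ->
  (forall U V x, U \in G -> V \in G -> x \in U -> x \in V -> U = V) ->
  partition G X.
Proof.
move=> sub n0 cov inj; apply/and3P; split.
- rewrite eqEsubset; apply/andP; split; first exact/bigcupsP.
  by apply/subsetP => x /cov[V GV Vx]; apply/bigcupP; exists V.
- apply/trivIsetP => U V GU GV; apply: contraR => /pred0Pn[x /andP[Ux Vx]].
  by apply/eqP; apply: inj Ux Vx.
- by apply/negP => /n0[x]; rewrite inE.
Qed.

Lemma partition_setU Y Z G1 G2 : [disjoint Y & Z] ->
  partition (G1 :|: G2) (Y :|: Z) &&
    (((G1 :|: G2) ::&: Y, (G1 :|: G2) ::&: Z) == (G1, G2)) =
  partition G1 Y && partition G2 Z.
Proof.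
move=> dYZ; have dis x : x \in Y -> x \in Z -> False.
  by move=> Yx Zx; have := disjointFr dYZ Yx; rewrite Zx.
apply/idP/idP => [/andP[pG /eqP[e1 e2]]|/andP[p1 p2]].
- have s1 V : V \in G1 -> V \subset Y by rewrite -e1 inE => /andP[].
  have s2 V : V \in G2 -> V \subset Z by rewrite -e2 inE => /andP[].
  apply/andP; split; apply: partitionI => //.
  + by move=> V GV; apply: (partition_inhab pG); rewrite inE GV.
  + move=> x Yx; have [|V] := partition_exists (x := x) pG;
      first by rewrite inE Yx.
    rewrite inE => /orP[GV Vx|GV Vx]; first by exists V.
    by case: (dis x Yx); apply: (subsetP (s2 _ GV)).
  + by move=> U V x GU GV; apply: (partition_inj pG); rewrite inE ?GU ?GV.
  + by move=> V GV; apply: (partition_inhab pG); rewrite inE GV orbT.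
  + move=> x Zx; have [|V] := partition_exists (x := x) pG;
      first by rewrite inE Zx orbT.
    rewrite inE => /orP[GV Vx|GV Vx]; last by exists V.
    by case: (dis x _ Zx); apply: (subsetP (s1 _ GV)).
  + by move=> U V x GU GV; apply: (partition_inj pG); rewrite inE ?GU ?GV orbT.
- have s1 := partition_sub p1; have s2 := partition_sub p2.
  apply/andP; split.
    apply: partitionI => [V|V|x|U V x].
    + by rewrite inE => /orP[/s1|/s2] sV; rewrite subsetU // sV ?orbT.
    + by rewrite inE => /orP[/(partition_inhab p1)|/(partition_inhab p2)].
    + by rewrite inE =>
        /orP[/(partition_exists p1)|/(partition_exists p2)] [V GV Vx];
        exists V; rewrite // inE GV ?orbT.
    + rewrite !inE => /orP[] GU /orP[] GV Ux Vx.
      * exact: (partition_inj p1 GU GV Ux Vx).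
      * by case: (dis x);
          [exact: (subsetP (s1 _ GU))|exact: (subsetP (s2 _ GV))].
      * by case: (dis x);
          [exact: (subsetP (s1 _ GV))|exact: (subsetP (s2 _ GU))].
      * exact: (partition_inj p2 GU GV Ux Vx).
  apply/eqP; congr (_, _); apply/setP => V; rewrite !inE.
    apply/andP/idP => [[/orP[//|GV] sV]|GV]; last by rewrite GV s1.
    have [x Vx] := partition_inhab p2 GV.
    by case: (dis x); [exact: (subsetP sV)|exact: (subsetP (s2 _ GV))].
  apply/andP/idP => [[/orP[GV|//] sV]|GV]; last by rewrite GV orbT s2.
  have [x Vx] := partition_inhab p1 GV.
  by case: (dis x); [exact: (subsetP (s1 _ GV))|exact: (subsetP sV)].
Qed.

Lemma partition_disjoint Y Z G1 G2 : [disjoint Y & Z] ->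
  partition G1 Y -> partition G2 Z -> [disjoint G1 & G2].
Proof.
move=> dYZ p1 p2; apply/pred0P => V /=; apply/negbTE/negP => /andP[G1V G2V].
have [x Vx] := partition_inhab p1 G1V.
have := disjointFr dYZ (subsetP (partition_sub p1 G1V) x Vx).
by rewrite (subsetP (partition_sub p2 G2V) x Vx).
Qed.

(** Summing a multiplicative weight over those partitions of a disjoint union
    none of whose blocks straddles the two parts. *)
Lemma sum_partition_setU (R : comPzSemiRingType) (F : {set T} -> R)
    (P : pred {set {set T}}) Y Z : [disjoint Y & Z] ->
  (forall G V, partition G (Y :|: Z) -> P G -> V \in G ->
     (V \subset Y) || (V \subset Z)) ->
  \sum_(G | partition G (Y :|: Z) && P G) \prod_(V in G) F V =
  \sum_(G1 | partition G1 Y) (\prod_(V in G1) F V) *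
    \sum_(G2 | partition G2 Z && P (G1 :|: G2)) \prod_(V in G2) F V.
Proof.
move=> dYZ sub.
rewrite (reindex_onto (fun g : {set {set T}} * {set {set T}} => g.1 :|: g.2)
          (fun G => (G ::&: Y, G ::&: Z))) /=; last first.
  move=> G /andP[pG PG]; apply/setP => V; rewrite !inE -andb_orr.
  by case GV: (V \in G); rewrite //= (sub G).
under [RHS]eq_bigr do rewrite big_distrr.
rewrite [RHS]pair_big_dep /=; apply: eq_big => [[G1 G2] | [G1 G2]] /=.
  by rewrite andbAC partition_setU // andbA.
rewrite andbAC partition_setU // => /andP[/andP[p1 p2] _].
rewrite -bigU ?(partition_disjoint dYZ) //.
by apply: eq_bigl => V; rewrite !inE.
Qed.

End PartitionElements.

(** * Monochrome noncrossing partitions *)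

Section Admissible.
Variables (I : Type) (eps : I -> I -> bool).

(** The decoration is constant on each block. *)
Definition monochrome n (d : 'I_n -> I) (G : {set {set 'I_n}}) : Prop :=
  forall V x y, V \in G -> x \in V -> y \in V -> d x = d y.

(** No two distinct blocks with non-commuting decorations cross. *)
Definition uncrossed n (d : 'I_n -> I) (G : {set {set 'I_n}}) : Prop :=
  forall U V u v u' v', U \in G -> V \in G -> U <> V ->
    u \in U -> u' \in U -> v \in V -> v' \in V ->
    (u < v)%N -> (v < u')%N -> (u' < v')%N -> eps (d u) (d v) = true.

Definition admissible n (d : 'I_n -> I) (G : {set {set 'I_n}}) : Prop :=
  monochrome d G /\ uncrossed d G.

(** The word read at the positions in [X] is reduced. *)
Definition reduced_on n (d : 'I_n -> I) (X : {set 'I_n}) : Prop :=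
  forall k l, k \in X -> l \in X -> (k < l)%N -> d k = d l ->
  exists p,
    [/\ p \in X, (k < p < l)%N, d p <> d k & eps (d p) (d k) = false].

Lemma admissibleS n (d : 'I_n -> I) (G H : {set {set 'I_n}}) :
  G \subset H -> admissible d H -> admissible d G.
Proof.
move=> /subsetP sGH [mono unc]; split=> [V x y /sGH|U V u v u' v' /sGH HU /sGH].
  exact: mono.
exact: unc.
Qed.

Hypothesis eps_sym : forall i j, eps i j = eps j i.

(** The witness is the block whose least element is largest: every other block
    has an element to its left. *)
Lemma innermost_block n (d : 'I_n -> I) (G : {set {set 'I_n}}) X x0 :
  partition G X -> admissible d G -> x0 \in X ->
  exists2 V, V \in G & forall x y y', x \in X -> x \notin V ->
    y \in V -> y' \in V -> (y < x < y')%N -> eps (d x) (d y) = true.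
Proof.
move=> pG [mono unc] Xx0.
pose least x := [exists V in G, (x \in V) && [forall y in V, x <= y]%N].
have leastP V x : V \in G -> x \in V -> exists2 w, w \in V & least w.
  move=> GV Vx; exists [arg min_(y < x | y \in V) y];
    case: arg_minnP => // w Vw minw.
  apply/existsP; exists V; rewrite GV Vw /=; apply/forallP => y.
  by apply/implyP => /minw.
have [V0 GV0 V0x0] := partition_exists pG Xx0.
have [w0 _ lw0] := leastP V0 x0 GV0 V0x0.
case: (arg_maxnP (fun x : 'I_n => x : nat) lw0) => m.
case/existsP=> V /andP[GV /andP[Vm /forallP minm]] maxm.
exists V => // x y y' Xx Vx Vy Vy' /andP[ltyx ltxy'].
have [W GW Wx] := partition_exists pG Xx.
have WV : W <> V by move=> e; rewrite -e Wx in Vx.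
have [w Ww lw] := leastP W x GW Wx.
have ltwy : (w < y)%N.
  have ltwm : (w < m)%N.
    rewrite ltn_neqAle (maxm w lw : w <= m)%N andbT; apply/eqP => /val_inj e;
      case: WV.
    by apply: (partition_inj pG GW GV Ww); rewrite e.
  by rewrite (leq_trans ltwm) //; have := minm y; rewrite Vy.
rewrite (mono W x w GW Wx Ww).
exact: (unc W V w y x y' GW GV WV Ww Wx Vy Vy' ltwy ltyx ltxy').
Qed.

(** A letter that recurs in a reduced word is separated from its recurrence by
    a non-commuting one, so that an innermost block is a singleton. *)
Lemma reduced_singleton n (d : 'I_n -> I) (G : {set {set 'I_n}}) X x0 :
  partition G X -> admissible d G -> x0 \in X ->
  reduced_on d X -> exists x, [set x] \in G.
Proof.
move=> pG adm Xx0 redX.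
have [V GV inner] := innermost_block pG adm Xx0.
have [x Vx] := partition_inhab pG GV; exists x; suff <- : V = [set x] by [].
have sV := subsetP (partition_sub pG GV).
have nolt k l : k \in V -> l \in V -> (k < l)%N -> False.
  move=> Vk Vl ltkl.
  have [p [Xp kpl neq e0]] :=
    redX k l (sV k Vk) (sV l Vl) ltkl (adm.1 V k l GV Vk Vl).
  have Vp : p \notin V by apply/negP => Vp; apply: neq; apply: adm.1 GV Vp Vk.
  by have := inner p k l Xp Vp Vk Vl kpl; rewrite e0.
apply/setP => y; rewrite inE; apply/idP/eqP => [Vy|->//].
apply/val_inj; case: (ltngtP y x) => // [/(nolt y x)|/(nolt x y)]; by case.
Qed.

(** Moves never exchange two non-commuting elements. *)
Lemma allowed_perm_lt n (d : 'I_n -> I) (G : {set {set 'I_n}}) s :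
  allowed_perm eps d G s ->
  forall x y, eps (d x) (d y) = false -> (x < y)%N -> (s x < s y)%N.
Proof.
elim=> [|{}s i j _ IH [ji e1 _]] x y exy ltxy; first by rewrite !perm1.
have := IH x y exy ltxy; rewrite !permM.
have nat_neq (k l : 'I_n) : k <> l -> k <> l :> nat by move=> kl /val_inj.
case: tpermP => [ex|ex|/nat_neq xi /nat_neq xj];
  case: tpermP => [ey|ey|/nat_neq yi /nat_neq yj]; rewrite ?ex ?ey; try lia.
by move: e1; rewrite /act_deco /= -ex -ey !permK exy.
Qed.

Section Incl.
Variables (n : nat) (X : {set 'I_n}).

Lemma incl_in (j : 'I_#|X|) : incl j \in X.
Proof. exact: enum_valP. Qed.

Lemma incl_inj : injective (@incl n X).
Proof. exact: enum_val_inj. Qed.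

Lemma incl_onto x : x \in X -> exists j : 'I_#|X|, x = incl j.
Proof.
by move=> Xx; exists (enum_rank_in Xx x); rewrite /incl enum_rankK_in.
Qed.

Lemma ltn_incl (j k : 'I_#|X|) : (incl j < incl k)%N = (j < k)%N.
Proof.
apply/idP/idP; last exact: incl_lt.
apply: contraTT; rewrite -!leqNgt leq_eqVlt => /orP[/eqP/val_inj->//|].
by move/incl_lt/ltnW.
Qed.

Lemma st_partition G : partition G X -> partition (st X G) setT.
Proof.
move=> pG; apply: partitionI => [V _|V|j _|U V j]; first exact: subsetT.
- case/imsetP=> W GW ->; have [x Wx] := partition_inhab pG GW.
  have [j e] := incl_onto (subsetP (partition_sub pG GW) x Wx).
  by exists j; rewrite inE -e.
- have [W GW Wj] := partition_exists pG (incl_in j).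
  by exists (@incl n X @^-1: W); rewrite ?inE //; apply: imset_f.
- case/imsetP=> U' GU' -> /imsetP[V' GV' ->]; rewrite !inE => Uj Vj.
  by rewrite (partition_inj pG GU' GV' Uj Vj).
Qed.

End Incl.

Lemma act_partition n (s : 'S_n) G X :
  partition G X -> partition (Defs.act s G) (s @: X).
Proof.
move=> pG; apply: partitionI => [V|V|x|U V x].
- by case/imsetP=> W GW ->; apply/imsetS/(partition_sub pG GW).
- case/imsetP=> W GW ->; have [x Wx] := partition_inhab pG GW.
  by exists (s x); apply: imset_f.
- case/imsetP=> y Xy ->; have [W GW Wy] := partition_exists pG Xy.
  by exists (s @: W); apply: imset_f.
- case/imsetP=> U' GU' -> /imsetP[V' GV' ->].
  move=> /imsetP[y Uy ->]; rewrite mem_imset => [Vy|]; last exact: perm_inj.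
  by rewrite (partition_inj pG GU' GV' Uy Vy).
Qed.

Lemma remove_block_partition (T : finType) (G : {set {set T}}) (B : {set T}) :
  partition G setT -> B \in G -> partition (G :\ B) (~: B).
Proof.
move=> pG GB; apply: partitionI => [V|V|x|U V x].
- rewrite !inE => /andP[/eqP VB GV]; apply/subsetP => x Vx; rewrite inE.
  by apply/negP => Bx; apply: VB; apply: (partition_inj pG GV GB Vx Bx).
- by rewrite !inE => /andP[_]; apply: partition_inhab pG.
- rewrite inE => Bx; have [|V GV Vx] := partition_exists (x := x) pG;
    first by rewrite inE.
  by exists V; rewrite // !inE GV andbT; apply: contraNneq Bx => <-.
- by rewrite !inE => /andP[_ GU] /andP[_ GV]; apply: (partition_inj pG).
Qed.

Lemma reduction_partition n (s : 'S_n) G B :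
  partition G setT -> B \in G ->
  partition (st (~: (s @: B)) (Defs.act s G :\ s @: B)) setT.
Proof.
move=> pG GB; apply/st_partition/remove_block_partition; last exact: imset_f.
suff <- : s @: setT = setT by apply: act_partition.
by apply/setP => x; rewrite inE -(permKV s x) imset_f // inE.
Qed.

(** A crossing in which consecutive elements do not commute survives all
    reductions that keep its two blocks, and prevents the removal of either.
    Blocks need not be monochrome here. *)
Lemma eps_noncrossing_uncrossed n (d : 'I_n -> I) (G : {set {set 'I_n}}) :
  eps_noncrossing eps d G -> partition G setT ->
  forall U V u v u' v', U \in G -> V \in G -> U <> V ->
    u \in U -> u' \in U -> v \in V -> v' \in V ->
    (u < v)%N -> (v < u')%N -> (u' < v')%N ->
    eps (d u) (d v) = false -> eps (d v) (d u') = false ->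
    eps (d u') (d v') = false -> False.
Proof.
elim=> {n d G} [d|n d G s B als GB [a [b intv]] _ IH] pG U V u v u' v' GU GV.
  by rewrite inE in GU.
move=> UV Uu Uu' Vv Vv' uv vu' u'v' euv evu' eu'v'.
have lt1 := allowed_perm_lt als euv uv.
have lt2 := allowed_perm_lt als evu' vu'.
have lt3 := allowed_perm_lt als eu'v' u'v'.
have ims x (W : {set 'I_n}) : (s x \in s @: W) = (x \in W).
  by rewrite mem_imset //; apply: perm_inj.
have nB W x : W \in G -> W <> B -> x \in W -> s x \in ~: (s @: B).
  move=> GW WB Wx; rewrite inE ims; apply/negP => Bx.
  by apply: WB; apply: (partition_inj pG GW GB Wx).
have UB : U <> B.
  move=> e; subst B; have: v \in U.
    have := intv (s u); have := intv (s u');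
      rewrite !ims Uu Uu' -(ims v) (intv (s v)).
    move=> /esym/andP[_ leb] /esym/andP[lea _].
    by rewrite (leq_trans lea (ltnW lt1)) (leq_trans (ltnW lt2)).
  by move=> Uv; apply: UV; apply: (partition_inj pG GU GV Uv).
have VB : V <> B.
  move=> e; subst B; have: u' \in V.
    have := intv (s v); have := intv (s v');
      rewrite !ims Vv Vv' -(ims u') (intv (s u')).
    move=> /esym/andP[_ leb] /esym/andP[lea _].
    by rewrite (leq_trans lea (ltnW lt2)) (leq_trans (ltnW lt3)).
  by move=> Vu'; apply: UV; apply: (partition_inj pG GU GV Uu').
have [u1 eu1] := incl_onto (nB U u GU UB Uu).
have [u1' eu1'] := incl_onto (nB U u' GU UB Uu').
have [v1 ev1] := incl_onto (nB V v GV VB Vv).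
have [v1' ev1'] := incl_onto (nB V v' GV VB Vv').
have inst W : W \in G -> W <> B ->
    @incl n (~: (s @: B)) @^-1: (s @: W) \in
      st (~: (s @: B)) (Defs.act s G :\ s @: B).
  move=> GW WB; apply: imset_f; rewrite !inE imset_f // andbT.
  by apply/eqP => /(imset_inj (@perm_inj _ s)).
have deco x j : s x = @incl n (~: (s @: B)) j ->
    (act_deco s d \o @incl n (~: (s @: B))) j = d x.
  by move=> e; rewrite /act_deco /= -e permK.
apply: (IH (reduction_partition s pG GB) _ _ u1 v1 u1' v1'
          (inst U GU UB) (inst V GV VB)).
- move=> /setP/(_ u1); rewrite !inE -eu1 !ims Uu => /esym Vu.
  by apply: UV; apply: (partition_inj pG GU GV Uu).
- by rewrite inE -eu1 ims.
- by rewrite inE -eu1' ims.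
- by rewrite inE -ev1 ims.
- by rewrite inE -ev1' ims.
- by rewrite -ltn_incl -eu1 -ev1.
- by rewrite -ltn_incl -eu1' -ev1.
- by rewrite -ltn_incl -eu1' -ev1'.
- by rewrite (deco _ _ eu1) (deco _ _ ev1).
- by rewrite (deco _ _ eu1') (deco _ _ ev1).
- by rewrite (deco _ _ eu1') (deco _ _ ev1').
Qed.

(** A block whose hull contains only commuting foreign elements can be made an
    interval: each move shifts one of its elements to the left. *)
Lemma gather_block n (d : 'I_n -> I) (G : {set {set 'I_n}}) V :
  partition G setT -> V \in G ->
  (forall x y y', x \notin V -> y \in V -> y' \in V -> (y < x < y')%N ->
     eps (d x) (d y) = true) ->
  monochrome d G ->
  exists s, allowed_perm eps d G s /\ is_interval (s @: V).
Proof.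
move=> pG GV comm mono.
have [v0 Vv0] := partition_inhab pG GV.
pose commuting (s : 'S_n) := forall x y y', x \notin V -> y \in V -> y' \in V ->
  (s y < s x < s y')%N -> eps (d x) (d y) = true.
(* Induction on the sum of the positions of [V]. *)
suff main m s : allowed_perm eps d G s -> commuting s ->
    (\sum_(v in V) s v < m)%N ->
    exists t, allowed_perm eps d G t /\ is_interval (t @: V).
  apply: (main _ 1%g (allowed_perm1 _ _ _) _ (ltnSn _)).
  by move=> x y y' Vx Vy Vy'; rewrite !perm1; apply: comm.
elim: m s => // m IHm s als coms ltm.
have ims x : (s x \in s @: V) = (x \in V).
  by rewrite mem_imset //; apply: perm_inj.
case: (arg_minnP (fun v => s v : nat) Vv0) => va Va mina.
have {Va}Vva : va \in V := Va.
case: (arg_maxnP (fun v => s v : nat) Vv0) => vb Vb maxb.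
have {Vb}Vvb : vb \in V := Vb.
case: (pickP [pred x | (x \notin V) && (s va < s x < s vb)%N]) =>
  [x /andP[Vx ltx]|noX]; last first.
  exists s; split=> //; exists (s va), (s vb) => x.
  rewrite -(permKV s x) ims; move: ((s^-1)%g x) => {}x.
  apply/idP/idP => [Vx|/andP[le1 le2]]; first by rewrite mina //=; apply: maxb.
  apply/negPn/negP => Vx; have := noX x; rewrite inE /= Vx /=.
  have ne y : y \in V -> s x <> s y :> nat.
    by move=> Vy /val_inj/perm_inj e; rewrite e Vy in Vx.
  by have := ne va Vva; have := ne vb Vvb; lia.
case: (@arg_maxnP _ x (fun x => (x \notin V) && (s va < s x < s vb)%N)
        (fun x => s x : nat)).
  by rewrite Vx.
(* [x] is now the rightmost foreign element in the hull, so that the position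
   after it belongs to [V]. *)
move=> {Vx ltx} x /andP[Vx /andP[lta ltb]] maxx.
have ltj : ((s x).+1 < n)%N by rewrite (leq_ltn_trans ltb).
pose j := Ordinal ltj; pose y := (s^-1)%g j.
have sy : s y = j by rewrite /y permKV.
have Vy : y \in V.
  apply/negPn/negP => Vy.
  have ne : s y <> s vb by move=> /perm_inj e; rewrite e Vvb in Vy.
  have ne' : s y <> s vb :> nat by move/val_inj.
  have syE : s y = (s x).+1 :> nat by rewrite sy.
  have := maxx y; rewrite Vy syE; move: ne'; rewrite syE; lia.
have xy : x != y by apply: contraNneq Vx => ->.
have tp z : z != x -> z != y -> tperm (s x) j (s z) = s z.
  by move=> zx zy; rewrite -sy tpermD // eq_sym (inj_eq perm_inj).
have ty : tperm (s x) j (s y) = s x by rewrite -sy tpermR.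
have exy : eps (d x) (d y) = true.
  rewrite (mono V y va GV Vy Vva); apply: (coms _ _ y) => //.
  by rewrite lta sy /=.
apply: (IHm (s * tperm (s x) j)%g).
- apply: allowed_permM als _; split=> //.
    by rewrite /act_deco /= permK.
  have [e|e] := pselect (act_deco s d (s x) = act_deco s d j); last by left.
  right; split=> // ebl.
  have pA : partition (Defs.act s G) (s @: setT) := act_partition s pG.
  have /and3P[/eqP cov triv _] := pA.
  have Vj : j \in s @: V by rewrite -sy ims.
  have := mem_pblock (Defs.act s G) (s x).
  rewrite ebl (def_pblock triv (imset_f _ GV) Vj) ims cov (negbTE Vx).
  by rewrite imset_f // inE.
- move=> z w w' Vz Vw Vw'; rewrite !permM.
  have [->{z Vz}|zx] := eqVneq z x.
    by move=> _; rewrite (mono V w y).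
  have zy : z != y by apply: contraNneq Vz => ->.
  rewrite (tp z) //.
  have wx : w != x by apply: contraNneq Vx => <-.
  have w'x : w' != x by apply: contraNneq Vx => <-.
  have szj : s z <> (s x).+1 :> nat.
    by move=> e; case/eqP: zy; apply: (@perm_inj _ s); apply: val_inj;
      rewrite sy.
  have low : (tperm (s x) j (s w) < s z)%N -> (s w < s z)%N.
    have [->|wy] := eqVneq w y; last by rewrite tp.
    by rewrite ty sy /= => ltz; rewrite ltn_neqAle ltz andbT; apply/eqP/nesym.
  have high : (s z < tperm (s x) j (s w'))%N -> (s z < s w')%N.
    have [->|w'y] := eqVneq w' y; last by rewrite tp.
    by rewrite ty sy /= => /ltnW; rewrite ltnS.
  by move=> /andP[/low ltw /high ltw']; apply: (coms z w w') => //; rewrite ltw.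
- rewrite ltnS in ltm; apply: leq_trans ltm;
    rewrite (bigD1 y) //= [X in (_ < X)%N](bigD1 y) //= permM ty sy.
  rewrite ltnS; apply: leq_add => //.
  apply: eq_leq; apply: eq_bigr => z /andP[Vz zy]; rewrite permM tp //.
  by apply: contraNneq Vx => <-.
Qed.

(** Among monochrome partitions, the inductive notion of an epsilon-noncrossing
    partition amounts to the absence of a crossing of two blocks whose
    decorations do not commute. *)
Lemma admissibleP n (d : 'I_n -> I) (G : {set {set 'I_n}}) :
  partition G setT -> monochrome d G ->
  eps_noncrossing eps d G <-> admissible d G.
Proof.
move=> pG mono; split=> [nc|adm].
  split=> // U V u v u' v' GU GV UV Uu Uu' Vv Vv' uv vu' u'v'.
  case euv: (eps _ _) => //; exfalso.
  apply: (eps_noncrossing_uncrossed nc pG GU GV UV Uu Uu' Vv Vv') => //.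
    by rewrite eps_sym -(mono U u u').
  by rewrite -(mono U u u') // -(mono V v v').
elim/ltn_ind: n d G pG mono adm => -[|n] IHn d G pG mono adm.
  suff -> : G = set0 by apply: eps_noncrossing_empty.
  apply/setP => V; rewrite inE; apply/negP => GV.
  by have [[]] := partition_inhab pG GV.
have [V GV inner] := innermost_block pG adm (in_setT ord0).
have [|s [als ints]] := gather_block pG GV _ mono.
  by move=> x y y' Vx Vy Vy'; apply: (inner x y y') => //; rewrite inE.
have [v Vv] := partition_inhab pG GV.
have ims x (W : {set 'I_n.+1}) : (s x \in s @: W) = (x \in W).
  by rewrite mem_imset //; apply: perm_inj.
apply: (eps_noncrossing_reduce als GV ints).
have instE (W' : {set 'I_#|~: (s @: V)|}) :
    W' \in st (~: (s @: V)) (Defs.act s G :\ s @: V) ->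
    exists2 W, W \in G & W' = @incl _ (~: (s @: V)) @^-1: (s @: W).
  case/imsetP=> W1; rewrite !inE => /andP[_ /imsetP[W GW ->]] ->; by exists W.
have mono' : monochrome (act_deco s d \o @incl _ (~: (s @: V)))
    (st (~: (s @: V)) (Defs.act s G :\ s @: V)).
  move=> _ x y /instE[W GW ->]; rewrite !inE /act_deco /=.
  rewrite -{1}(permKV s (incl x)) -{1}(permKV s (incl y)) !ims.
  exact: mono.
apply: IHn => //.
- rewrite -[X in (_ < X)%N](card_ord n.+1) -cardsT.
  apply: proper_card; rewrite properT; apply/eqP => /setP/(_ (s v)).
  by rewrite !inE ims Vv.
- exact: reduction_partition.
- split=> // _ _ u w u' w' /instE[U GU ->] /instE[W GW ->] UW.
  rewrite !inE /act_deco /= -!ltn_incl.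
  rewrite -(permKV s (incl u)) -(permKV s (incl w)).
  rewrite -(permKV s (incl u')) -(permKV s (incl w')).
  move: ((s^-1)%g (incl u)) ((s^-1)%g (incl w)).
  move: ((s^-1)%g (incl u')) ((s^-1)%g (incl w')).
  move=> {}u' {}w' {}u {}w; rewrite !ims !permK => Uu Uu' Ww Ww' l1 l2 l3.
  have {}UW : U <> W by move=> e; rewrite e in UW.
  case euw: (eps _ _) => //.
  (* The moves preserve the order of non-commuting elements, so the crossing
     was already there. *)
  have lift x y : eps (d x) (d y) = false -> (s x < s y)%N -> (x < y)%N.
    move=> exy lts; case: ltngtP => // [ltyx|/val_inj e].
      have := @allowed_perm_lt _ _ _ _ als y x;
        rewrite eps_sym exy => /(_ erefl ltyx).
      by move/(ltn_trans lts); rewrite ltnn.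
    by rewrite e ltnn in lts.
  rewrite -euw; apply: (adm.2 U W u w u' w') => //; apply: lift => //.
    by rewrite eps_sym -(mono U u u').
  by rewrite -(mono U u u') // -(mono W w w').
Qed.

End Admissible.

(** * Cumulants of subfamilies *)

Section Increasing.
Variables (m n : nat) (f : 'I_m -> 'I_n).
Hypothesis f_lt : forall j k : 'I_m, (j < k)%N -> (f j < f k)%N.

(** An increasing map is determined by its image, hence is [incl] of it. *)
Lemma increasing_incl (V : {set 'I_n}) : V = f @: setT ->
  exists e : m = #|V|, forall j, f j = incl (cast_ord e j).
Proof.
have enum_lt k (W : {set 'I_k}) : sorted ltn (map val (enum W)).
  rewrite -[enum W]/(filter (mem W) (Finite.enum 'I_k)).
  apply: (subseq_sorted ltn_trans (map_subseq _ (filter_subseq _ _))).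
  by rewrite -enumT val_enum_ord iota_ltn_sorted.
move=> VE; have e : map (fun j => val (f j)) (enum 'I_m) = map val (enum V).
  apply: (irr_sorted_eq ltn_trans ltnn) => // [|x].
    have := enum_lt m setT; rewrite enum_setT -enumT !sorted_map.
    by apply: sub_sorted => j k /f_lt.
  apply/mapP/mapP => [[j _ ->]|[y]].
    by exists (f j); rewrite // mem_enum VE imset_f ?inE.
  by rewrite mem_enum VE => /imsetP[j _ ->] ->; exists j; rewrite // mem_enum.
have em : m = #|V|.
  rewrite -[LHS]size_enum_ord -(size_map (fun j => val (f j))).
  by rewrite e size_map -cardE.
exists em => j; apply: val_inj; rewrite /= /incl (enum_val_nth (f j)) /=.
rewrite -(nth_map (f j) 0%N val) -?cardE -?em ?ltn_ord // -e.
by rewrite (nth_map j) ?size_enum_ord ?ltn_ord // nth_ord_enum.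
Qed.

End Increasing.

Section Cumulants.
Variables (K : fieldType) (A : algType K) (phi : {scalar A}).
Variables (I : Type) (eps : I -> I -> bool).
Hypothesis eps_sym : forall i j, eps i j = eps j i.
Hypothesis phi1 : phi 1 = 1.

(** The cumulant of the subfamily of [a] indexed by [V]. *)
Definition block_cumulant n (d : 'I_n -> I) (a : 'I_n -> A)
    (V : {set 'I_n}) : K :=
  cumulant phi eps (d \o @incl n V) (a \o @incl n V).

(** The moment of the subfamily of [a] indexed by [X]. *)
Definition moment n (a : 'I_n -> A) (X : {set 'I_n}) : K :=
  phi (\prod_(x in X) a x).

(** Cumulants are invariant under increasing relabellings. *)
Lemma block_cumulant_incr m n (f : 'I_m -> 'I_n) (d : 'I_n -> I) a :
  (forall j k : 'I_m, (j < k)%N -> (f j < f k)%N) ->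
  cumulant phi eps (d \o f) (a \o f) = block_cumulant d a (f @: setT).
Proof.
move=> f_lt; have [e fE] := increasing_incl f_lt erefl.
move: (f @: setT) e fE => V e fE; rewrite /block_cumulant.
have -> : f = @incl n V \o cast_ord e by apply/funext.
move: (@incl n V) => g; case: #|V| / e g {fE} => g.
suff -> : g \o cast_ord erefl = g by [].
by apply/funext => j /=; rewrite cast_ord_id.
Qed.

Lemma eq_block_cumulant n (d : 'I_n -> I) a a' (V : {set 'I_n}) :
  {in V, a =1 a'} -> block_cumulant d a V = block_cumulant d a' V.
Proof.
move=> aa'; rewrite /block_cumulant; congr cumulant.
by apply/funext => j; apply/aa'/incl_in.
Qed.

Section Lift.
Variables (n : nat) (B : {set 'I_n}).

(** The partition of [B] that corresponds to a partition of its
    standardization. *)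
Definition unst (G : {set {set 'I_#|B|}}) : {set {set 'I_n}} :=
  [set @incl n B @: V | V : {set 'I_#|B|} in G].

Lemma unstK : cancel unst (st B).
Proof.
move=> G; rewrite /st /unst -imset_comp -[RHS]imset_id; apply: eq_imset => V /=.
by apply/setP => j; rewrite !inE mem_imset //; apply: incl_inj.
Qed.

Lemma stK G : partition G B -> unst (st B G) = G.
Proof.
move=> pG; rewrite /st /unst -imset_comp -[RHS]imset_id;
  apply: eq_in_imset => V GV /=.
apply/setP => x; apply/imsetP/idP => [[j + ->]|Vx]; first by rewrite inE.
have [j e] := incl_onto (subsetP (partition_sub pG GV) x Vx).
by exists j; rewrite // inE -e.
Qed.

Lemma unst_partition G : partition (unst G) B = partition G setT.
Proof.
apply/idP/idP => pG; first by rewrite -(unstK G); apply: st_partition.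
apply: partitionI => [V|V|x Bx|U V x].
- by case/imsetP=> W _ ->; apply/subsetP => x /imsetP[j _ ->]; apply: incl_in.
- case/imsetP=> W GW ->; have [j Wj] := partition_inhab pG GW.
  by exists (incl j); apply: imset_f.
- have [j ->] := incl_onto Bx;
    have [V GV Vj] := partition_exists pG (in_setT j).
  by exists (@incl n B @: V); apply: imset_f.
- case/imsetP=> U' GU' -> /imsetP[V' GV' ->] /imsetP[j Uj ->].
  rewrite mem_imset => [Vj|]; last exact: incl_inj.
  by rewrite (partition_inj pG GU' GV' Uj Vj).
Qed.

Lemma unst_admissible (d : 'I_n -> I) G :
  admissible eps d (unst G) <-> admissible eps (d \o @incl n B) G.
Proof.
have mem j (W : {set 'I_#|B|}) : (incl j \in @incl n B @: W) = (j \in W).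
  by rewrite mem_imset //; apply: incl_inj.
have memG (W : {set 'I_#|B|}) : W \in G -> @incl n B @: W \in unst G.
  by move=> GW; apply: imset_f.
split=> -[mono unc]; split.
- move=> V x y /memG GV Vx Vy; apply: (mono _ _ _ GV); by rewrite mem.
- move=> U V u v u' v' GU GV UV Uu Uu' Vv Vv' uv vu' u'v'.
  apply: (unc _ _ _ _ (incl u') (incl v') (memG U GU) (memG V GV));
    rewrite ?mem ?ltn_incl //.
  by move=> /(imset_inj (@incl_inj _ _)).
- move=> _ _ _ /imsetP[V GV ->] /imsetP[x Vx ->] /imsetP[y Vy ->].
  exact: (mono V).
- move=> _ _ _ _ _ _ /imsetP[U GU ->] /imsetP[V GV ->] UV
    /imsetP[u Uu ->] /imsetP[u' Uu' ->] /imsetP[v Vv ->] /imsetP[v' Vv' ->].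
  rewrite !ltn_incl; apply: (unc U V) => // e; apply: UV; by rewrite e.
Qed.

End Lift.

Lemma partition_of_set0 (T : finType) (G : {set {set T}}) :
  partition G set0 = (G == set0).
Proof.
apply/idP/eqP => [pG|->]; last first.
  by apply: partitionI => [V|V|x|U V x]; rewrite inE.
apply/setP => V; rewrite inE; apply/negP => GV.
have [x Vx] := partition_inhab pG GV.
by have := subsetP (partition_sub pG GV) x Vx; rewrite inE.
Qed.

Lemma admissible0 n (d : 'I_n -> I) : admissible eps d set0.
Proof.
by split=> [V x y|U V u v u' v']; rewrite inE.
Qed.

(** On positions with a common decoration the moment-cumulant formula is a sum
    over admissible partitions. *)
Lemma moment_monochrome n (d : 'I_n -> I) a (B : {set 'I_n}) :
  {in B &, forall x y, d x = d y} ->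
  moment a B =
  \sum_(G | partition G B && `[< admissible eps d G >])
     \prod_(V in G) block_cumulant d a V.
Proof.
move=> dB; have [->|[b Bb]] := set_0Vmem B.
  rewrite /moment big_set0 phi1 (big_pred1 set0) ?big_set0 // => G.
  rewrite partition_of_set0 /=; case: eqP => //= ->.
  by apply/asboolP/admissible0.
have B0 : (0 < #|B|)%N by apply/card_gt0P; exists b.
rewrite /moment prod_incl (moment_cumulant phi eps (d \o @incl n B)) //.
rewrite (reindex_onto (@unst n B) (st B)) /=; last first.
  by move=> G /andP[pG _]; apply: stK.
apply: eq_big => [G|G _].
  rewrite inE unstK eqxx andbT unst_partition.
  case pG: (partition G setT) => //=; apply/asbool_equiv_eq.
  apply: iff_trans (iff_sym (unst_admissible _ _)).
  apply: admissibleP => // V x y _ _ _ /=; apply: dB; exact: incl_in.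
rewrite /unst big_imset /=; last by move=> U V _ _; apply/imset_inj/incl_inj.
apply: eq_bigr => V _.
rewrite -[_ \o _ \o _]/(d \o (@incl n B \o @incl _ V)).
rewrite -[X in cumulant _ _ _ X]/(a \o (@incl n B \o @incl _ V)).
rewrite block_cumulant_incr => [|j k ltjk]; last by rewrite /= !ltn_incl.
rewrite imset_comp; suff -> : @incl _ V @: setT = V by [].
apply/setP => x; apply/imsetP/idP => [[j _ ->]|Vx]; first exact: incl_in.
by have [j ->] := incl_onto Vx; exists j.
Qed.

(** * The sum over monochrome noncrossing partitions *)

Section Sum.
Variables (n : nat) (d : 'I_n -> I).
Implicit Types (a : 'I_n -> A) (G : {set {set 'I_n}}) (V W X Y B : {set 'I_n}).
Implicit Types (x y z w : 'I_n).

(** The total weight of the partitions of [X] that complete [G0] to an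
    admissible family of blocks. *)
Definition cumulant_sum a G0 X : K :=
  \sum_(G | partition G X && `[< admissible eps d (G0 :|: G) >])
     \prod_(V in G) block_cumulant d a V.

Lemma eq_cumulant_sum a a' G0 X :
  {in X, a =1 a'} -> cumulant_sum a G0 X = cumulant_sum a' G0 X.
Proof.
move=> aa'; apply: eq_bigr => G /andP[pG _]; apply: eq_bigr => V GV.
apply: eq_block_cumulant => x Vx; apply: aa'.
exact: (subsetP (partition_sub pG GV)).
Qed.

Lemma cumulant_sum0 a : cumulant_sum a set0 set0 = 1.
Proof.
rewrite /cumulant_sum (big_pred1 set0) ?big_set0 // => G.
rewrite partition_of_set0 /=; case: eqP => //= ->.
by rewrite setU0; apply/asboolP/admissible0.
Qed.

(** Positions of colour [c] are linked when no block of [G0] separates them: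
    the elements of a block that do not commute with [c] are either all between
    the two positions or all outside. For [w] distinct from [x] and [y],
    [(x < w) (+) (y < w)] says that [w] is between [x] and [y]. *)
Definition linked G0 (c : I) (x y : 'I_n) : bool :=
  [forall W in G0, forall w in W, forall w' in W,
     ~~ eps (d w) c && ~~ eps (d w') c ==>
       ((x < w)%N (+) (y < w)%N == (x < w')%N (+) (y < w')%N)].

Lemma linkedP G0 c x y :
  reflect (forall W w w', W \in G0 -> w \in W -> w' \in W ->
     eps (d w) c = false -> eps (d w') c = false ->
     (x < w)%N (+) (y < w)%N = (x < w')%N (+) (y < w')%N) (linked G0 c x y).
Proof.
apply: (iffP forall_inP) => H W.
  move=> w w' GW Ww Ww' e e'.
  have /forall_inP/(_ w Ww)/forall_inP/(_ w' Ww') := H W GW.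
  by rewrite e e' => /eqP.
move=> GW; apply/forall_inP => w Ww; apply/forall_inP => w' Ww'.
by apply/implyP => /andP[/negbTE e /negbTE e']; apply/eqP; exact: (H W).
Qed.

Lemma linked_refl G0 c x : linked G0 c x x.
Proof. by apply/linkedP => W w w' _ _ _ _ _; rewrite !addbb. Qed.

Lemma linked_sym G0 c x y : linked G0 c x y = linked G0 c y x.
Proof.
apply/linkedP/linkedP => H W w w' GW Ww Ww' e e'.
  by rewrite addbC (H W w w') // addbC.
by rewrite addbC (H W w w') // addbC.
Qed.

Lemma linked_trans G0 c y x z :
  linked G0 c x y -> linked G0 c y z -> linked G0 c x z.
Proof.
move=> /linkedP xy /linkedP yz; apply/linkedP => W w w' GW Ww Ww' e e'.
have e1 := xy W w w' GW Ww Ww' e e'; have e2 := yz W w w' GW Ww Ww' e e'.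
by rewrite -(addbK (y < w)%N (x < w)%N) e1 -addbA e2 addbA addbK.
Qed.

(** The blocks of colour [c] of an admissible partition consist of linked
    positions. *)
Lemma linked_block G0 c Y G V x y :
  (forall z, z \in Y -> d z = c) ->
  (forall W w, W \in G0 -> w \in W -> w \notin Y) ->
  partition G Y -> admissible eps d (G0 :|: G) ->
  V \in G -> x \in V -> y \in V -> linked G0 c x y.
Proof.
move=> dY dis pG [mono unc] GV.
have sV := subsetP (partition_sub pG GV).
have inV : V \in G0 :|: G by rewrite inE GV orbT.
have key W w w' x' y' : W \in G0 -> w \in W -> w' \in W ->
    eps (d w) c = false ->
    x' \in V -> y' \in V -> (x' < w < y')%N -> (x' < w' < y')%N.
  move=> GW Ww Ww' e Vx Vy /andP[xw wy].
  have inW : W \in G0 :|: G by rewrite inE GW.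
  have WV : W <> V by move=> eWV; have := dis W w GW Ww; rewrite sV // -eWV.
  have ne z : z \in V -> w' <> z.
    by move=> Vz ez; have := dis W w' GW Ww'; rewrite sV // ez.
  apply/negPn/negP => /nandP[]; rewrite -leqNgt leq_eqVlt.
    case/predU1P=> [/val_inj/(ne x' Vx)//|lt].
    have := unc W V w' x' w y' inW inV WV Ww' Ww Vx Vy lt xw wy.
    by rewrite (mono W w' w) // (dY x' (sV x' Vx)) e.
  case/predU1P=> [/val_inj/esym/(ne y' Vy)//|lt].
  have := unc V W x' w y' w' inV inW (nesym WV) Vx Vy Ww Ww' xw wy lt.
  by rewrite eps_sym (dY x' (sV x' Vx)) e.
have key2 x' y' : x' \in V -> y' \in V -> (x' < y')%N -> linked G0 c x' y'.
  move=> Vx Vy ltxy; apply/linkedP => W w w' GW Ww Ww' e e'.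
  have k1 := key W w w' x' y' GW Ww Ww' e Vx Vy.
  have k2 := key W w' w x' y' GW Ww' Ww e' Vx Vy.
  have ne z v : z \in V -> v \in W -> v <> z :> nat.
    by move=> Vz Wv /val_inj ez; have := dis W v GW Wv; rewrite sV // ez.
  have := ne x' w Vx Ww; have := ne y' w Vy Ww.
  have := ne x' w' Vx Ww'; have := ne y' w' Vy Ww'.
  by move: k1 k2 ltxy; clear; lia.
move=> Vx Vy; case: (ltngtP x y) => [|ltyx|/val_inj ->]; first exact: key2.
  by rewrite linked_sym; apply: key2.
exact: linked_refl.
Qed.

(** If the chords [u u'] and [v v'] cross and [w], [w'] are on the same side of
    each of them, then they are on the same side of the chord [u v]. *)
Lemma crossing_xor (u v u' v' w w' : nat) :
  (u < v)%N -> (v < u')%N -> (u' < v')%N ->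
  (u < w)%N (+) (u' < w)%N = (u < w')%N (+) (u' < w')%N ->
  (v < w)%N (+) (v' < w)%N = (v < w')%N (+) (v' < w')%N ->
  (u < w)%N (+) (v < w)%N = (u < w')%N (+) (v < w')%N.
Proof. lia. Qed.

Lemma crossing_linked G0 c (u v u' v' : 'I_n) :
  (u < v)%N -> (v < u')%N -> (u' < v')%N ->
  linked G0 c u u' -> linked G0 c v v' -> linked G0 c u v.
Proof.
move=> uv vu' u'v' /linkedP uu' /linkedP vv';
  apply/linkedP => W w w' GW Ww Ww' e e'.
by apply: crossing_xor uv vu' u'v' _ _; [exact: (uu' W)|exact: (vv' W)].
Qed.

(** A class [B] of linked positions of colour [c] contributes its moment, as a
    factor: blocks do not leave [B], and they are not constrained by the
    others. *)
Lemma cumulant_sum_class a G0 c Y B :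
  (forall z, z \in Y -> d z = c) ->
  (forall W w, W \in G0 -> w \in W -> w \notin Y) ->
  B \subset Y ->
  {in B &, forall x y, linked G0 c x y} ->
  (forall x y, x \in B -> y \in Y -> linked G0 c x y -> y \in B) ->
  cumulant_sum a G0 Y = moment a B * cumulant_sum a G0 (Y :\: B).
Proof.
move=> dY dis sBY linkB closB.
have YE : Y = B :|: (Y :\: B) by rewrite -{1}(setID Y B) (setIidPr sBY).
have dB x : x \in B -> d x = c by move/(subsetP sBY)/dY.
have disB W w : W \in G0 -> w \in W -> w \notin B.
  by move=> GW Ww; apply: contra (dis W w GW Ww); apply: (subsetP sBY).
have dYB x : x \in Y :\: B -> d x = c by move/(subsetP (subsetDl _ _))/dY.
have disYB W w : W \in G0 -> w \in W -> w \notin Y :\: B.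
  by move=> GW Ww; apply: contra (dis W w GW Ww);
    apply: (subsetP (subsetDl _ _)).
rewrite {1}/cumulant_sum {1}YE.
rewrite (sum_partition_setU (block_cumulant d a)
          (P := fun G => `[< admissible eps d (G0 :|: G) >])); last first.
- move=> G V; rewrite -YE => pG /asboolP adm GV.
  have sV := subsetP (partition_sub pG GV).
  have [x0 Vx0] := partition_inhab pG GV.
  have lk x y : x \in V -> y \in V -> linked G0 c x y.
    exact: (linked_block dY dis pG adm GV).
  have [Bx0|Bx0] := boolP (x0 \in B); apply/orP; [left|right];
    apply/subsetP => y Vy.
    by apply: (closB x0) => //; [exact: sV|exact: lk].
  rewrite inE sV // andbT; apply: contra Bx0 => By.
  by apply: (closB y) => //; [exact: sV|exact: lk].
- by rewrite disjoint_sym disjoints_subset; apply/subsetP => x;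
    rewrite !inE => /andP[].
rewrite (@moment_monochrome _ d) => [|x y Bx By]; last by rewrite !dB.
rewrite [RHS]big_distrl /= [RHS]big_mkcondr /=; apply: eq_bigr => G1 p1.
have [adm1|nadm1] := asboolP (admissible eps d G1); last first.
  rewrite [X in _ * X]big_pred0 ?mulr0 // => G2;
    apply/negbTE/negP => /andP[_ /asboolP adm].
  by apply/nadm1/(admissibleS _ adm); rewrite setUCA subsetUl.
congr (_ * _); apply: eq_bigl => G2; apply: andb_id2l => p2.
apply/asboolP/asboolP => [|adm2]; first by apply: admissibleS;
  rewrite setUS ?subsetUr.
have cases V : V \in G0 :|: (G1 :|: G2) -> V \in G1 \/ V \in G0 :|: G2.
  by rewrite !inE => /or3P[]->; rewrite ?orbT; auto.
split=> [V x y /cases[]|]; [exact: adm1.1|exact: adm2.1|].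
have s1 V x : V \in G1 -> x \in V -> x \in B.
  by move=> GV; apply: subsetP (partition_sub p1 GV) x.
(* A crossing of a block inside [B] with a block outside [B]: the latter either
   belongs to [G0], and would separate elements of [B], or has colour [c], and
   would be linked to [B]. *)
have mix U V u v u' v' : U \in G1 -> V \in G0 :|: G2 ->
    u \in U -> u' \in U -> v \in V -> v' \in V ->
    ((u < v) && (v < u') && (u' < v') || (v < u) && (u < v') && (v' < u'))%N ->
    eps (d u) (d v) = true.
  move=> GU GV Uu Uu' Vv Vv' cross.
  rewrite eps_sym (dB u (s1 U u GU Uu)); case e: (eps _ _) => //; exfalso.
  have luu' := linkB u u' (s1 U u GU Uu) (s1 U u' GU Uu').
  move: (GV); rewrite inE => /orP[G0V|G2V].
    have e' : eps (d v') c = false by rewrite (adm2.1 V v' v).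
    have := linkedP _ _ _ _ luu' V v v' G0V Vv Vv' e e'.
    have ne z w : z \in U -> w \in V -> w <> z :> nat.
      by move=> Uz Vw /val_inj ez; have := disB V w G0V Vw; rewrite ez (s1 U).
    have := ne u v Uu Vv; have := ne u' v Uu' Vv.
    have := ne u v' Uu Vv'; have := ne u' v' Uu' Vv'.
    by move: cross; clear; lia.
  have lvv' : linked G0 c v v' by apply: (linked_block dYB disYB p2 adm2 G2V).
  have := subsetP (partition_sub p2 G2V) v Vv;
    rewrite inE => /andP[/negP Bv Yv].
  apply: Bv; apply: (closB u) => //; first exact: (s1 U).
  case/orP: cross => /andP[/andP[l1 l2] l3].
    exact: (crossing_linked l1 l2 l3 luu' lvv').
  by rewrite linked_sym; apply: (crossing_linked l1 l2 l3 lvv' luu').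
move=> U V u v u' v' /cases[G1U|GU] /cases[G1V|GV] UV Uu Uu' Vv Vv' l1 l2 l3.
- exact: (adm1.2 U V u v u' v').
- by apply: (mix U V u v u' v') => //; rewrite l1 l2 l3.
- by rewrite eps_sym; apply: (mix V U v u v' u') => //; rewrite l1 l2 l3 orbT.
- exact: (adm2.2 U V u v u' v').
Qed.

(** The positions of colour [c] in [X]. *)
Definition colour X c : {set 'I_n} := [set x in X | `[< d x = c >]].

(** The positions of colour [c] in [X] that are linked to [q]. *)
Definition class G0 X c q : {set 'I_n} :=
  [set x in colour X c | linked G0 c q x].

Lemma in_colour X c x : (x \in colour X c) = (x \in X) && `[< d x = c >].
Proof. by rewrite inE. Qed.

(** The blocks of colour [c] are summed last, the other blocks [G0] being
    fixed. *)
Lemma cumulant_sum_colour a X c :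
  cumulant_sum a set0 X =
  \sum_(G0 | partition G0 (X :\: colour X c))
     (\prod_(V in G0) block_cumulant d a V) * cumulant_sum a G0 (colour X c).
Proof.
have sub : colour X c \subset X by apply/subsetP => x; rewrite inE => /andP[].
have XE : X = (X :\: colour X c) :|: colour X c.
  by rewrite setUC -{1}(setID X (colour X c)) (setIidPr sub).
rewrite {1}/cumulant_sum {1}XE.
rewrite (sum_partition_setU (block_cumulant d a)
          (P := fun G => `[< admissible eps d (set0 :|: G) >])); last first.
- move=> G V; rewrite -XE set0U => pG /asboolP [mono _] GV.
  have sV := subsetP (partition_sub pG GV).
  have [x0 Vx0] := partition_inhab pG GV.
  have dV y : y \in V -> d y = d x0 by move=> Vy; apply: (mono V).
  have [e|e] := pselect (d x0 = c); apply/orP; [right|left];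
    apply/subsetP => y Vy.
    by rewrite in_colour sV //=; apply/asboolP; rewrite dV.
  by rewrite inE in_colour sV //= andbT; apply/asboolPn; rewrite dV.
- by rewrite disjoints_subset; apply/subsetP => x; rewrite !inE => /andP[].
by apply: eq_bigr => G0 _; congr (_ * _); apply: eq_bigl => G; rewrite set0U.
Qed.

(** Isolating the argument [q]: it enters only through one moment. *)
Lemma cumulant_sum_at a X q : q \in X ->
  let c := d q in
  cumulant_sum a set0 X =
  \sum_(G0 | partition G0 (X :\: colour X c))
     (\prod_(V in G0) block_cumulant d a V) *
     (moment a (class G0 X c q) *
      cumulant_sum a G0 (colour X c :\: class G0 X c q)).
Proof.
move=> Xq c; rewrite (cumulant_sum_colour a X c); apply: eq_bigr => G0 p0.
congr (_ * _); apply: (@cumulant_sum_class _ _ c).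
- by move=> z; rewrite in_colour => /andP[_ /asboolP].
- by move=> W w GW /(subsetP (partition_sub p0 GW)); rewrite inE => /andP[].
- by apply/subsetP => x; rewrite inE => /andP[].
- move=> x y; rewrite inE => /andP[_ qx]; rewrite inE => /andP[_ qy].
  by apply: linked_trans qy; rewrite linked_sym.
- move=> x y; rewrite inE => /andP[_ qx] Yy xy.
  by rewrite inE Yy; apply: linked_trans xy.
Qed.

(** Deleting the position [q], provided the moment of its class absorbs it. *)
Lemma cumulant_sum_drop a a' X q : q \in X ->
  let c := d q in
  (forall G0, partition G0 (X :\: colour X c) ->
    {in X, forall y, y \notin class G0 X c q -> a y = a' y} /\
    moment a (class G0 X c q) = moment a' (class G0 X c q :\ q)) ->
  cumulant_sum a set0 X = cumulant_sum a' set0 (X :\ q).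
Proof.
move=> Xq c drop; rewrite (cumulant_sum_at a Xq) (cumulant_sum_colour a' _ c).
have cE : colour (X :\ q) c = colour X c :\ q.
  by apply/setP => x; rewrite !inE andbA.
have cq : q \in colour X c by rewrite in_colour Xq; apply/asboolP.
have restE : X :\ q :\: colour (X :\ q) c = X :\: colour X c.
  rewrite cE; apply/setP => x; rewrite !inE.
  by case: eqVneq => //= ->; rewrite Xq andbT; apply/esym/negbTE;
    rewrite negbK; apply/asboolP.
rewrite restE; apply: eq_bigr => G0 p0; have [aa' mom] := drop G0 p0.
have clq : q \in class G0 X c q by rewrite inE cq linked_refl.
have sub0 V x : V \in G0 -> x \in V -> (x \in X) && (x \notin colour X c).
  by move=> GV /(subsetP (partition_sub p0 GV)); rewrite inE andbC.
congr (_ * _).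
  apply: eq_bigr => V GV; apply: eq_block_cumulant => x Vx.
  have /andP[Xx cx] := sub0 V x GV Vx.
  by apply: aa' => //; apply: contra cx; rewrite inE => /andP[].
rewrite cE (@cumulant_sum_class a' G0 c _ (class G0 X c q :\ q)).
- rewrite mom; congr (_ * _).
  have -> : colour X c :\ q :\: (class G0 X c q :\ q) =
      colour X c :\: class G0 X c q.
    by apply/setP => x; rewrite !in_setD !in_set1; case: eqVneq => //= ->;
      rewrite clq.
  apply: eq_cumulant_sum => x; rewrite inE => /andP[clx cx]; apply: aa' => //.
  by move: cx; rewrite inE => /andP[].
- by move=> z /setD1P[_]; rewrite in_colour => /andP[_ /asboolP].
- move=> W w GW Ww; have /andP[_] := sub0 W w GW Ww; apply: contra.
  by case/setD1P.
- by apply: setSD; apply/subsetP => x; rewrite inE => /andP[].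
- move=> x y; rewrite !inE => /and3P[_ _ qx] /and3P[_ _ qy].
  by apply: linked_trans qy; rewrite linked_sym.
- move=> x y /setD1P[_]; rewrite inE => /andP[_ qx] /setD1P[yq cy] xy.
  by rewrite in_setD1 yq inE cy; apply: linked_trans xy.
Qed.

End Sum.

(** * Stability of the sum under the operations of the algebra *)

Section Stability.
Variables (n : nat) (d : 'I_n -> I).
Implicit Types (a : 'I_n -> A) (G : {set {set 'I_n}}) (V W X Y B : {set 'I_n}).
Implicit Types (p q x y z w : 'I_n).

Lemma moment_linear a X q (t : K) b1 b2 : q \in X ->
  moment (upd a q (b1 + t *: b2)) X =
  moment (upd a q b1) X + t * moment (upd a q b2) X.
Proof.
move=> Xq; have [L [M prodE]] := prod_upd a Xq.
by rewrite /moment !prodE mulrDr mulrDl -scalerAr -scalerAl linearD scalarZ.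
Qed.

Lemma moment_upd1 a X q : moment (upd a q 1) X = moment (upd a q 1) (X :\ q).
Proof.
rewrite /moment prod_upd1; congr (phi _); apply: eq_bigr => y.
by case/setD1P => yq _; rewrite upd_out.
Qed.

Lemma cumulant_sum_linear a X q (t : K) b1 b2 : q \in X ->
  cumulant_sum d (upd a q (b1 + t *: b2)) set0 X =
  cumulant_sum d (upd a q b1) set0 X + t * cumulant_sum d (upd a q b2) set0 X.
Proof.
move=> Xq; rewrite !(cumulant_sum_at d _ Xq) /= big_distrr -big_split /=.
apply: eq_bigr => G0 p0.
have cq : q \in colour d X (d q) by rewrite in_colour Xq; apply/asboolP.
have clq : q \in class d G0 X (d q) q by rewrite inE cq linked_refl.
have same1 b : \prod_(V in G0) block_cumulant d (upd a q b) V =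
               \prod_(V in G0) block_cumulant d a V.
  apply: eq_bigr => V GV; apply: eq_block_cumulant => x Vx; rewrite upd_out //.
  have := subsetP (partition_sub p0 GV) x Vx; rewrite inE => /andP[+ _].
  by apply: contraNneq => ->.
have same2 b : cumulant_sum d (upd a q b) G0
                 (colour d X (d q) :\: class d G0 X (d q) q) =
               cumulant_sum d a G0 (colour d X (d q) :\: class d G0 X (d q) q).
  apply: eq_cumulant_sum => x; rewrite inE => /andP[clx _]; rewrite upd_out //.
  by apply: contraNneq clx => ->.
rewrite !same1 !same2 (moment_linear _ _ _ _ clq) mulrDl mulrDr -mulrA.
by rewrite (mulrCA _ t).
Qed.

Lemma cumulant_sum_upd1 a X q : q \in X ->
  cumulant_sum d (upd a q 1) set0 X = cumulant_sum d (upd a q 1) set0 (X :\ q).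
Proof.
by move=> Xq; apply: cumulant_sum_drop => // G0 _; rewrite -moment_upd1.
Qed.

Lemma cumulant_sum_merge a X p q : p \in X -> q \in X -> (p < q)%N ->
  d p = d q ->
  (forall y, y \in X -> (p < y < q)%N ->
    d y <> d q /\ eps (d y) (d q) = true) ->
  cumulant_sum d a set0 X = cumulant_sum d (upd a p (a p * a q)) set0 (X :\ q).
Proof.
move=> Xp Xq pq dpq btw; apply: cumulant_sum_drop => // G0 p0.
have cp : p \in colour d X (d q) by rewrite in_colour Xp; apply/asboolP.
have cq : q \in colour d X (d q) by rewrite in_colour Xq; apply/asboolP.
have clq : q \in class d G0 X (d q) q by rewrite inE cq linked_refl.
have clp : p \in class d G0 X (d q) q.
  rewrite inE cp /=; apply/linkedP => W w w' GW Ww Ww' e e'.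
  (* No element of a block that must not cross [q] lies between [p] and [q]. *)
  have side v : v \in W -> eps (d v) (d q) = false -> (q < v)%N = (p < v)%N.
    move=> Wv ev; have := subsetP (partition_sub p0 GW) v Wv.
    rewrite inE => /andP[cv Xv]; apply/idP/idP => [/(ltn_trans pq)//|pv].
    rewrite ltnNge leq_eqVlt; apply/negP => /predU1P[/val_inj vq|vq].
      by rewrite vq cq in cv.
    by have [|_] := btw v Xv; rewrite ?pv ?vq // ev.
  by rewrite (side w) // (side w') // !addbb.
split=> [y _ cly|]; first by rewrite upd_out //; apply: contraNneq cly => ->.
congr (phi _); apply: prod_merge => // y; rewrite inE in_colour.
move=> /andP[/andP[Xy /asboolP dy] _] pyq.
by have [] := btw y Xy pyq.
Qed.

End Stability.

(** * Moments of independent families *)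

Lemma block_cumulant1 n (d : 'I_n -> I) a x :
  block_cumulant d a [set x] = phi (a x).
Proof.
have := @moment_monochrome n d a [set x]; rewrite /moment big_set1 => ->.
  rewrite (big_pred1 [set [set x]]) ?big_set1 // => G /=.
  apply/andP/eqP => [[pG _]|->].
    have blk V : V \in G -> V = [set x].
      move=> GV; have := partition_sub pG GV;
        rewrite subset1 => /orP[/eqP//|/eqP V0].
      by have [y] := partition_inhab pG GV; rewrite V0 inE.
    apply/setP => V; rewrite inE; apply/idP/eqP => [/blk//|->].
    by have [W GW _] := partition_exists pG (set11 x); rewrite -(blk W).
  split; first apply: partitionI => [V|V|y|U V y]; rewrite ?inE.
  - by move/eqP->.
  - by move/eqP->; exists x; rewrite inE.
  - by move/eqP->; exists [set x]; rewrite inE.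
  - by move=> /eqP-> /eqP->.
  apply/asboolP; split=> [V y z|U V u v u' v']; rewrite !inE => /eqP->.
    by rewrite !inE => /eqP-> /eqP->.
  by move=> /eqP->.
by move=> y z; rewrite !inE => /eqP-> /eqP->.
Qed.

(** Reduced words: every term has a factor [phi (a x) = 0]. *)
Lemma cumulant_sum_reduced n (d : 'I_n -> I) a (X : {set 'I_n}) x0 : x0 \in X ->
  reduced_on eps d X -> (forall x, x \in X -> phi (a x) = 0) ->
  cumulant_sum d a set0 X = 0.
Proof.
move=> Xx0 Xred a0; apply: big1 => G /andP[pG /asboolP]; rewrite set0U => adm.
have [x Gx] := reduced_singleton pG adm Xx0 Xred.
have Xx := subsetP (partition_sub pG Gx) x (set11 x).
by rewrite (bigD1 _ Gx) /= block_cumulant1 a0 // mul0r.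
Qed.

(** Every moment can be evaluated by three operations: merging two factors from
    the same algebra that meet after commutations, dropping a unit, and
    discarding a centered reduced word. The sum over admissible partitions obeys
    the same rules. *)
Lemma moment_cumulant_sum (S : I -> {pred A}) :
  (forall i, GRing.subalg_closed (S i)) -> eps_independent phi eps S ->
  forall n (d : 'I_n -> I) (X : {set 'I_n}) a, (forall x, a x \in S (d x)) ->
  moment a X = cumulant_sum d a set0 X.
Proof.
move=> Ssub [Scomm Sind] n d X.
move: {2}(#|X|.+1) (ltnSn #|X|) => m; elim: m X => // m IHm X ltm a Sa.
have [->|[x0 Xx0]] := set_0Vmem X.
  by rewrite cumulant_sum0 /moment big_set0 phi1.
have ltD q : q \in X -> (#|X :\ q| < m)%N.
  by move=> Xq; move: ltm; rewrite (cardsD1 q X) Xq.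
have Supd a' q b : (forall x, a' x \in S (d x)) -> b \in S (d q) ->
    forall x, upd a' q b x \in S (d x).
  by move=> Sa' Sb x; rewrite /upd; case: eqP => [->|].
have [[k [l [Xk Xl kl dkl adj]]]|nadj] := pselect (exists k l,
   [/\ k \in X, l \in X, (k < l)%N, d l = d k &
    forall p, p \in X -> (k < p < l)%N -> d p <> d k ->
      eps (d p) (d k) = true]).
  (* The first recurrence of the letter at [k] can be moved next to [k]. *)
  pose P q := [&& q \in X, (k < q)%N & `[< d q = d k >]].
  have Pl : P l by rewrite /P Xl kl; apply/asboolP.
  case: (arg_minnP (fun q : 'I_n => q : nat) Pl) =>
    q /and3P[Xq kq /asboolP dq] minq.
  have btw y : y \in X -> (k < y < q)%N -> d y <> d q /\ eps (d y) (d q) = true.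
    move=> Xy /andP[ky yq]; have dy : d y <> d k.
      move=> dy; have /minq : P y by rewrite /P Xy ky; apply/asboolP.
      by rewrite leqNgt yq.
    by rewrite dq; split=> //; apply: adj;
      rewrite // ky (leq_trans yq (minq l Pl)).
  rewrite (cumulant_sum_merge a Xk Xq kq (esym dq) btw).
  rewrite -IHm ?ltD //; last first.
    by apply: Supd => //; have [_ _ SM] := Ssub (d k); apply: SM;
      rewrite // -dq.
  congr (phi _); apply: prod_merge => // y Xy kyq.
  by have [dyq eyq] := btw y Xy kyq; apply: (Scomm (d y) (d q)).
have Xred : reduced_on eps d X.
  move=> k l Xk Xl kl dkl; apply: contrapT => nex; apply: nadj; exists k, l;
    split=> //.
  move=> p Xp kpl dpk; apply/negPn/negP => /negbTE epk.
  by apply: nex; exists p.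
(* In a reduced word the arguments are centered one at a time. *)
move: {2}(#|[set x in X | phi (a x) != 0]|.+1)
  (ltnSn #|[set x in X | phi (a x) != 0]|) => r.
elim: r a Sa => // r IHr a Sa ltr.
have [nc0|[q]] := set_0Vmem [set x in X | phi (a x) != 0].
  have a0 x : x \in X -> phi (a x) = 0.
    by move=> Xx; have /setP/(_ x) := nc0; rewrite !inE Xx /= => /negbFE/eqP.
  rewrite (cumulant_sum_reduced Xx0) //.
  rewrite /moment prod_incl; apply: (Sind _ (d \o @incl n X)) => [||j|j].
  - by apply/card_gt0P; exists x0.
  - move=> k l kl dkl;
      have [||||p [Xp /andP[kp pl] dpk epk]] := Xred (incl k) (incl l);
      rewrite ?incl_in ?ltn_incl //.
    have [p1 e] := incl_onto Xp; subst p; exists p1; split=> //.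
    by rewrite -!(@ltn_incl n X) kp pl.
  - exact: Sa.
  - by apply: a0; apply: incl_in.
rewrite inE => /andP[Xq nq].
have [S1 SL _] := Ssub (d q).
pose b := a q - phi (a q) *: 1.
have Sb : b \in S (d q).
  by rewrite /b addrC -scaleNr; apply: SL.
have phib : phi b = 0 by rewrite /b linearB scalarZ phi1 mulr1 subrr.
have aE : a = upd a q (b + phi (a q) *: 1) by rewrite /b subrK upd_id.
rewrite aE moment_linear // cumulant_sum_linear //; congr (_ + _ * _).
  apply: IHr; first exact: Supd.
  move: ltr; rewrite ltnS; apply: leq_trans.
  apply: proper_card; apply/properP; split.
    apply/subsetP => x; rewrite !inE; have [->|xq] := eqVneq x q.
      by rewrite upd_at phib eqxx andbF.
    by rewrite upd_out.
  by exists q; rewrite inE ?Xq // upd_at phib eqxx.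
by rewrite moment_upd1 cumulant_sum_upd1 // IHm ?ltD //; apply: Supd.
Qed.

(** The moment-cumulant formula, with its monochrome terms set apart. *)
Lemma moment_cumulant_monochrome n (d : 'I_n -> I) (a : 'I_n -> A) :
  (0 < n)%N ->
  phi (\prod_(j < n) a j) =
  cumulant_sum d a set0 setT +
  \sum_(G in eps_nc_partitions eps d | ~~ `[< monochrome d G >])
     \prod_(V in G) block_cumulant d a V.
Proof.
move=> n0; rewrite (moment_cumulant phi eps d) //.
rewrite (bigID (fun G => `[< monochrome d G >])) /=; congr (_ + _).
apply: eq_bigl => G; rewrite set0U inE -andbA; apply: andb_id2l => pG.
apply/andP/asboolP => [[/asboolP nc /asboolP mono]|adm].
  exact/(admissibleP eps_sym pG mono).
by split; apply/asboolP; [apply/(admissibleP eps_sym pG adm.1)|exact: adm.1].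
Qed.

End Cumulants.

Lemma not_monochrome n (I : Type) (d : 'I_n -> I) (G : {set {set 'I_n}}) :
  ~ monochrome d G -> exists2 V, V \in G &
    exists l k : 'I_#|V|, (l < k)%N /\ d (incl l) <> d (incl k).
Proof.
move=> nmono; apply: contrapT => nex; apply: nmono => V x y GV Vx Vy.
apply: contrapT => dxy; apply: nex; exists V => //.
have [j ej] := incl_onto Vx; have [k ek] := incl_onto Vy; subst x y.
case: (ltngtP j k) => [jk|kj|/val_inj jk]; first by exists j, k.
  by exists k, j; split=> // /esym.
by rewrite jk in dxy.
Qed.

(** * The equivalence *)

Theorem theorem10 (K : fieldType) (charK : [pchar K] =i pred0)
    (A : algType K) (phi : {scalar A}) (phi1 : phi 1 = 1)
    (I : Type) (eps : I -> I -> bool)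
    (eps_sym : forall i j : I, eps i j = eps j i)
    (S : I -> {pred A})
    (S_subalg : forall i : I, GRing.subalg_closed (S i))
    (S_comm : forall i j : I, i <> j -> eps i j = true ->
       forall a b : A, a \in S i -> b \in S j -> a * b = b * a) :
  eps_independent phi eps S <->
  (forall (n : nat) (i : 'I_n -> I) (a : 'I_n -> A), (2 <= n)%N ->
     (forall j : 'I_n, a j \in S (i j)) ->
     (exists l k : 'I_n, (l < k)%N /\ i l <> i k) ->
     cumulant phi eps i a = 0).
Proof.
split=> [indep n|vanish].
  (* The one-block partition is the only mixed term without a smaller mixed
     block. *)
  elim/ltn_ind: n => n IHn d a n2 Sa [l [k [_ dlk]]].
  have n0 : (0 < n)%N by apply: ltnW.
  have := moment_cumulant_monochrome phi eps_sym d a n0.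
  have -> : \prod_(j < n) a j = \prod_(j in [set: 'I_n]) a j.
    by apply: eq_bigl => j; rewrite inE.
  rewrite -/(moment phi a setT).
  rewrite (moment_cumulant_sum eps_sym phi1 S_subalg indep setT Sa).
  have T0 : [set: 'I_n] != set0 by rewrite -card_gt0 cardsT card_ord.
  have Tnc : ([set setT] \in eps_nc_partitions eps d) &&
             ~~ `[< monochrome d [set [set: 'I_n]] >].
    rewrite inE -andbA; apply/and3P; split.
    - by rewrite /partition cover1 eqxx trivIset1 inE eq_sym T0.
    - by apply/asboolP/eps_noncrossing1.
    - by apply/asboolPn => /(_ setT l k);
        rewrite !inE => /(_ (eqxx _) erefl erefl).
  rewrite (bigD1 [set setT]) /=; last exact: Tnc.
  rewrite big_set1 /block_cumulant cumulant_setT big1 => [|G].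
    by rewrite addr0 -[X in X = _]addr0 => /addrI.
  case/andP=> /andP[]; rewrite inE => /andP[pG _] /asboolPn nmono GT.
  have [V GV [j [j' [ltj dj]]]] := not_monochrome nmono.
  have /andP[_ ltV] := card_block pG GV GT.
  rewrite (bigD1 _ GV) /= IHn ?mul0r // => [|i|].
  - by rewrite (leq_ltn_trans _ (ltn_ord j')) // (leq_trans _ ltj).
  - exact: Sa.
  - by exists j, j'.
split=> // n d a n0 dred Sa a0.
rewrite (moment_cumulant_monochrome phi eps_sym d a n0).
rewrite (@cumulant_sum_reduced _ _ phi _ _ eps_sym phi1
          _ _ _ _ (Ordinal n0)) ?inE //; last first.
  move=> k l _ _ kl dkl; have [p [kpl dpk epk]] := dred k l kl dkl.
  by exists p; rewrite inE.
rewrite add0r big1 // => G /andP[_ /asboolPn nmono].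
have [V GV [j [j' [ltj dj]]]] := not_monochrome nmono.
rewrite (bigD1 _ GV) /= /block_cumulant vanish ?mul0r // => [|i|].
- by rewrite (leq_ltn_trans _ (ltn_ord j')) // (leq_trans _ ltj).
- exact: Sa.
- by exists j, j'.
Qed.
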